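(* For all convex bodies $K,T\in\mathcal{K}_0^n$ the following hold. (1) $K'\subseteq K^{\circ}$, with an equality if and only if $K$ is a Euclidean ball. (2) If $K\supseteq T$ then $K'\subseteq T'$. (3) $K''\supseteq K$. (4) $K'''=K'$.
   Context: A convex body in $\mathbb{R}^n$ is a closed convex set $K\subseteq\mathbb{R}^n$ with $0\in K$ (not assumed compact, nor with non-empty interior); $\mathcal{K}_0^n$ is the set of all convex bodies. The support function of $K\in\mathcal{K}_0^n$ is $h_K:S^{n-1}\to[0,\infty]$, $h_K(\theta)=\sup_{x\in K}\langle x,\theta\rangle$, where $S^{n-1}$ is the unit Euclidean sphere. The polar is $K^\circ=\{y\in\mathbb{R}^n:\langle x,y\rangle\le 1\text{ for all }x\in K\}$. For $g:S^{n-1}\to[0,\infty]$ its Alexandrov body is $A[g]=\{x\in\mathbb{R}^n:\langle x,\theta\rangle\le g(\theta)\text{ for all }\theta\in S^{n-1}\}$. The reciprocal body of $K\in\mathcal{K}_0^n$ is $K'=A[1/h_K]\in\mathcal{K}_0^n$, with $1/0=\infty$, $1/\infty=0$; $K''=(K')'$ and $K'''=(K'')'$.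
   Formalization: The equality case in (1) is stated only for n ≠ 1 (for n = 1, K = [0,∞) has K' = K° but is not a ball), and ''Euclidean ball'' means a ball centred at the origin with radius in [0,∞], so that {0} and R^n count as balls. *)

(* Defs.v *)
From HB Require Import structures.
From mathcomp Require Import all_boot all_order all_algebra.
From mathcomp Require Import all_classical all_reals all_analysis.

Set Implicit Arguments.
Unset Strict Implicit.
Unset Printing Implicit Defensive.

Import Order.TTheory GRing.Theory Num.Theory.
Import numFieldNormedType.Exports.

Local Open Scope classical_set_scope.
Local Open Scope ring_scope.

Section reciprocal.
Variables (R : realType) (n : nat).
Implicit Types (K : set 'rV[R]_n) (x y theta : 'rV[R]_n).

Definition dot x y : R := \sum_(i < n) x 0 i * y 0 i.

(* The library norm on row vectors is the sup norm; the topology is the same,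
   but the Euclidean length has to be defined separately. *)
Definition enorm x : R := Num.sqrt (dot x x).

Definition usphere : set 'rV[R]_n := [set theta | enorm theta = 1].

(* Neither boundedness nor non-empty interior is required. *)
Definition convex_body K : Prop := [/\ closed K, convex_set K & K 0].

(* Functions on the sphere are represented by functions on the whole space of
   which only the values on the sphere are ever used. *)
Definition support_fun K theta : \bar R :=
  ereal_sup [set (dot x theta)%:E | x in K].

Definition polar K : set 'rV[R]_n :=
  [set y | forall x, K x -> dot x y <= 1].

Definition alexandrov_body (g : 'rV[R]_n -> \bar R) : set 'rV[R]_n :=
  [set x | forall theta, usphere theta -> ((dot x theta)%:E <= g theta)%E].

(* The inverse on \bar R satisfies 0^-1 = +oo and +oo^-1 = 0. *)
Definition reciprocal K : set 'rV[R]_n :=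
  alexandrov_body (fun theta => (support_fun K theta)^-1%E).

(* Balls are centred at the origin and the radius ranges over [0, +oo]: {0} and
   R^n, which are each other's polar and reciprocal bodies, count as balls.
   In dimension 1 the reciprocal and polar bodies always coincide, even for
   K = [0, +oo[, so balls are characterized by this equality only if n != 1. *)
Definition euclidean_ball K : Prop :=
  exists2 r : \bar R, (0 <= r)%E & K = [set x | ((enorm x)%:E <= r)%E].

End reciprocal.

(* Main.v *)
Require Import Defs.
From HB Require Import structures.
From mathcomp Require Import all_boot all_order all_algebra.
From mathcomp Require Import all_classical all_reals all_analysis.
From mathcomp Require Import ring lra.

Import Order.TTheory GRing.Theory Num.Theory.
Import numFieldNormedType.Exports.

Local Open Scope classical_set_scope.
Local Open Scope ring_scope.

(** For a unit vector [theta] and [0 \in K], the inequality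
    [<y, theta> <= 1 / h_K(theta)] says, when [<y, theta> > 0], that
    [<x, theta> <y, theta> <= 1] for every [x] in [K]. If [<y, theta>] is
    negative the same can be said of [- theta], and the product does not see the
    sign. Hence, by homogeneity ([reciprocalP]),
      [y \in K'] iff [<x, theta> <y, theta> <= <theta, theta>]
                 for all [x \in K] and all vectors [theta].
    This relation between [x] and [y] is symmetric, so the reciprocal body is the
    polarity of a Galois connection: it reverses inclusions, a body is contained
    in its second reciprocal, and the third reciprocal is the first. Taking
    [theta = y] shows that [K'] is contained in the polar [K^o]. For a ball the
    Cauchy-Schwarz inequality gives the converse inclusion ([ball_reciprocal]).

    Conversely let [K' = K^o]. Dividing the above inequality by
    [<theta, theta>] shows that the orthogonal projection of a point [x] of [K]
    onto the line of [theta] pairs to at most [1] with each [y] in [K^o]; by the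
    bipolar theorem it belongs to [K] ([reciprocal_eq_polar_proj]). So [K] is
    stable under orthogonal projection onto all lines through the origin. Turning
    a point by a small angle [d] in this way costs only a factor [cos d], that is
    a relative loss of order [d^2]. A rotation by a fixed acute angle, cut into
    [m] equal steps, therefore loses [O(1/m)], and since [K] is closed it
    contains, with [x], every point of the same length ([proj_stable_sphere]). In
    dimension one there is no way to turn from [x] to [- x], hence the exception.
    Being convex and closed, [K] is then the ball whose radius is the supremum of
    the lengths of its points ([proj_stable_ball]). *)

(** * The Euclidean inner product *)

Section dot_theory.
Context {R : realType} {n : nat}.
Implicit Types (x y z : 'rV[R]_n) (a : R).

Lemma dotC x y : dot x y = dot y x.
Proof. by apply: eq_bigr => i _; rewrite mulrC. Qed.

Lemma dotDl x y z : dot (x + y) z = dot x z + dot y z.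
Proof.
by rewrite /dot -big_split; apply: eq_bigr => i _; rewrite mxE mulrDl.
Qed.

Lemma dotZl a x y : dot (a *: x) y = a * dot x y.
Proof. by rewrite /dot mulr_sumr; apply: eq_bigr => i _; rewrite mxE mulrA. Qed.

Lemma dotNl x y : dot (- x) y = - dot x y.
Proof. by rewrite -scaleN1r dotZl mulN1r. Qed.

Lemma dot0l x : dot 0 x = 0.
Proof. by rewrite -(scale0r x) dotZl mul0r. Qed.

Lemma dotDr x y z : dot x (y + z) = dot x y + dot x z.
Proof. by rewrite dotC dotDl !(dotC x). Qed.

Lemma dotZr a x y : dot x (a *: y) = a * dot x y.
Proof. by rewrite dotC dotZl dotC. Qed.

Lemma dotNr x y : dot x (- y) = - dot x y.
Proof. by rewrite dotC dotNl dotC. Qed.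

Definition dotE := (dotDl, dotDr, dotNl, dotNr, dotZl, dotZr).

Lemma dot_ge0 x : 0 <= dot x x.
Proof. by apply: sumr_ge0 => i _; rewrite -expr2 sqr_ge0. Qed.

Lemma dot_eq0 x : (dot x x == 0) = (x == 0).
Proof.
apply/eqP/eqP => [/eqP|->]; last exact: dot0l.
rewrite /dot psumr_eq0 => [/allP h|i _]; last by rewrite -expr2 sqr_ge0.
apply/rowP => i; have := h i (mem_index_enum _).
by rewrite -expr2 sqrf_eq0 mxE => /eqP.
Qed.

Lemma dot_gt0 x : (0 < dot x x) = (x != 0).
Proof. by rewrite lt_def dot_ge0 andbT dot_eq0. Qed.

Lemma sqr_enorm x : enorm x ^+ 2 = dot x x.
Proof. by rewrite sqr_sqrtr // dot_ge0. Qed.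

Lemma enorm_ge0 x : 0 <= enorm x.
Proof. exact: sqrtr_ge0. Qed.

Lemma enormZ a x : 0 <= a -> enorm (a *: x) = a * enorm x.
Proof.
move=> a0; rewrite /enorm !dotE mulrA -expr2.
by rewrite sqrtrM ?sqr_ge0// sqrtr_sqr ger0_norm.
Qed.

Lemma enorm_gt0 x : (0 < enorm x) = (x != 0).
Proof. by rewrite sqrtr_gt0 dot_gt0. Qed.

(** Expand the squared length of [<y, y> x - <x, y> y]. *)
Lemma cauchy_schwarz x y : dot x y ^+ 2 <= dot x x * dot y y.
Proof.
have [->|y0] := eqVneq y 0.
  by rewrite !(dotC _ 0) !dot0l mulr0 expr2 mulr0.
have yy : 0 < dot y y by rewrite dot_gt0.
have := dot_ge0 (dot y y *: x - dot x y *: y).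
rewrite !dotE (dotC y x) => h.
rewrite -subr_ge0 -(pmulr_rge0 _ yy); apply: le_trans h _.
by rewrite le_eqVlt; apply/orP; left; apply/eqP; ring.
Qed.

Lemma dot_le_enorm x y : dot x y <= enorm x * enorm y.
Proof.
apply: le_trans (ler_norm _) _; rewrite -sqrtr_sqr -sqrtrM ?dot_ge0//.
by rewrite ler_sqrt ?cauchy_schwarz// mulr_ge0 ?dot_ge0.
Qed.

Lemma dot_continuous (f g : 'rV[R]_n -> 'rV[R]_n) :
  continuous f -> continuous g -> continuous (fun x => dot (f x) (g x)).
Proof.
move=> cf cg; rewrite /dot; apply: continuous_big => [|i _ x].
  exact: add_continuous.
apply: continuousM.
  exact: (continuous_comp (cf x) (@coord_continuous R 1 n 0 i (f x))).
exact: (continuous_comp (cg x) (@coord_continuous R 1 n 0 i (g x))).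
Qed.

(** Swap two coordinates, one of them nonzero, and change one sign. For [n = 0]
    there is no [x != 0], so that [n = 1] is the only exception. *)
Lemma exists_orthogonal x : n <> 1%N -> x != 0 -> exists2 z, z != 0 & dot x z = 0.
Proof.
move=> n1 x0.
have /existsP[i xi] : [exists i, x 0 i != 0].
  rewrite -negb_forall; apply: contra x0 => /forallP h; apply/eqP/rowP => i.
  by rewrite mxE; apply/eqP.
have [j ji] : exists j, j != i.
  apply/existsP; rewrite -negb_forall; apply/negP => /forallP h.
  apply: n1; rewrite -[LHS]card_ord; apply/eqP/fintype1P; exists i => j.
  by apply/eqP; rewrite h.
exists (x 0 j *: delta_mx 0 i - x 0 i *: delta_mx 0 j).
  apply: contraNneq xi => /rowP/(_ j); rewrite !mxE !eqxx (negbTE ji) /=.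
  by rewrite mulr0 mulr1 sub0r => /eqP; rewrite oppr_eq0.
have de l : dot x (delta_mx 0 l) = x 0 l.
  rewrite /dot (bigD1 l)//= mxE !eqxx mulr1 big1 ?addr0// => k kl.
  by rewrite mxE (negbTE kl) andbF mulr0.
by rewrite !dotE !de; ring.
Qed.

End dot_theory.

(** * Reciprocal bodies as a polarity *)

Section reciprocal_theory.
Context {R : realType} {n : nat}.
Implicit Types (K T : set 'rV[R]_n) (x y theta : 'rV[R]_n).

(** For [a > 0] both sides say that [h_K(theta) <= 1 / a]; [0 \in K] makes
    [h_K] nonnegative, so that nothing is required of [a <= 0], and the
    conventions [1 / 0 = +oo] and [1 / +oo = 0] need no separate treatment. *)
Lemma le_inv_support K theta (a : R) : K 0 ->
  (a%:E <= (support_fun K theta)^-1)%E <->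
  (0 < a -> forall x, K x -> dot x theta * a <= 1).
Proof.
move=> K0; have h0 : (0 <= support_fun K theta)%E.
  by apply: ereal_sup_ubound; exists 0; rewrite ?dot0l.
have [a0|a0] := leP a 0.
  by split=> // _; apply: (@le_trans _ _ 0%E); rewrite ?lee_fin// inve_ge0.
rewrite inve_pge ?inE ?lee_fin ?(ltW a0)// inver gt_eqF//; split=> [h _ x Kx|h].
  rewrite -ler_pdivlMr// div1r -lee_fin; apply: le_trans h.
  by apply: ereal_sup_ubound; exists x.
apply: ge_ereal_sup => _ [x Kx <-].
by rewrite lee_fin -div1r ler_pdivlMr// h.
Qed.

(** The right-hand side is symmetric in [x] and [y], which is what turns
    [reciprocal] into a polarity. *)
Lemma reciprocalP K y : K 0 ->
  reciprocal K y <->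
  forall x theta, K x -> dot x theta * dot y theta <= dot theta theta.
Proof.
move=> K0; split=> [h x theta Kx|h theta th1].
  (* The product is even in [theta]. *)
  wlog y0 : theta / 0 < dot y theta.
    move=> wl; have [yt|yt|->] := ltgtP (dot y theta) 0; last 2 first.
    - exact: wl.
    - by rewrite mulr0 dot_ge0.
    by have := wl (- theta); rewrite !dotE !mulrNN opprK oppr_gt0; exact.
  have th0 : 0 < enorm theta.
    by rewrite enorm_gt0; apply: contraTneq y0 => ->; rewrite dotC dot0l ltxx.
  pose u := (enorm theta)^-1 *: theta.
  have u1 : usphere u.
    by rewrite /usphere /= enormZ ?invr_ge0 ?enorm_ge0// mulVf ?gt_eqF.
  have /(le_inv_support _ _ _ K0) := h _ u1.
  rewrite /u !dotE mulr_gt0 ?invr_gt0// => /(_ isT x Kx).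
  rewrite dotZr mulrACA -expr2 exprVn sqr_enorm mulrC ler_pdivrMr ?mul1r//.
  by rewrite -sqr_enorm exprn_gt0.
apply/le_inv_support => // _ x Kx.
by rewrite (le_trans (h x theta Kx))// -sqr_enorm th1 expr1n.
Qed.

Lemma reciprocal0 K : K 0 -> reciprocal K 0.
Proof.
by move=> K0; apply/reciprocalP => // x t _; rewrite dot0l mulr0 dot_ge0.
Qed.

Lemma sub_reciprocal2 K : K 0 -> K `<=` reciprocal (reciprocal K).
Proof.
move=> K0 x Kx; apply/reciprocalP; first exact: reciprocal0.
by move=> y t /(reciprocalP _ _ K0) h; rewrite mulrC h.
Qed.

Lemma reciprocalS K T : K 0 -> T 0 -> T `<=` K -> reciprocal K `<=` reciprocal T.
Proof.
move=> K0 T0 TK y /(reciprocalP _ _ K0) h; apply/reciprocalP => // x t Tx.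
exact/h/TK.
Qed.

Lemma reciprocal3 K : K 0 ->
  reciprocal (reciprocal (reciprocal K)) = reciprocal K.
Proof.
move=> K0; have K'0 := reciprocal0 _ K0; have K''0 := reciprocal0 _ K'0.
apply/seteqP; split; last exact: sub_reciprocal2.
exact: reciprocalS K''0 K0 (sub_reciprocal2 _ K0).
Qed.

Lemma reciprocal_sub_polar K : K 0 -> reciprocal K `<=` polar K.
Proof.
move=> K0 y /(reciprocalP _ _ K0) h x Kx.
have [->|y0] := eqVneq y 0; first by rewrite dotC dot0l ler01.
by have := h x y Kx; rewrite ger_pMl ?dot_gt0.
Qed.

(** If [x] is in the ball then so is the vector of length [|x|] in the direction
    of [y]; pairing it with [y] in the polar gives [|x| |y| <= 1], and two
    applications of the Cauchy-Schwarz inequality conclude. *)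
Lemma ball_reciprocal K : euclidean_ball K -> reciprocal K = polar K.
Proof.
move=> [r r0 KE]; have K0 : K 0 by rewrite KE /= /enorm dot0l sqrtr0.
apply/seteqP; split; first exact: reciprocal_sub_polar.
move=> y Ky; apply/reciprocalP => // x t Kx.
have xy1 : enorm x * enorm y <= 1.
  have [->|y0] := eqVneq y 0.
    by rewrite {2}/enorm dot0l sqrtr0 mulr0 ler01.
  have ny : 0 < enorm y by rewrite enorm_gt0.
  have c0 : 0 <= enorm x / enorm y by rewrite divr_ge0 ?enorm_ge0.
  have /Ky : K ((enorm x / enorm y) *: y).
    by move: Kx; rewrite KE /= enormZ// divfK ?gt_eqF.
  by rewrite dotZl -sqr_enorm expr2 mulrA divfK ?gt_eqF.
apply: le_trans (ler_norm _) _; rewrite normrM.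
have nd z : `|dot z t| <= enorm z * enorm t.
  rewrite ler_norml dot_le_enorm andbT lerNl.
  by rewrite -dotNr (le_trans (dot_le_enorm _ _))// /enorm dotNr dotNl opprK.
apply: le_trans (ler_pM _ _ (nd x) (nd y)) _ => //.
by rewrite mulrACA -expr2 sqr_enorm ler_piMl ?dot_ge0.
Qed.

End reciprocal_theory.

(** * Closed convex sets and the bipolar theorem *)

Section convex.
Context {R : realType} {n : nat}.
Implicit Types (K : set 'rV[R]_n) (x y p q : 'rV[R]_n).

Lemma convex_body_conv K x y (t : R) : convex_body K -> K x -> K y ->
  0 <= t <= 1 -> K (t *: x + (1 - t) *: y).
Proof.
move=> [_ cK _] Kx Ky /andP[t0 t1].
by have := cK x y (Itv01 t0 t1) (mem_set Kx) (mem_set Ky); rewrite inE.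
Qed.

Lemma convex_body_shrink K x (t : R) : convex_body K -> K x ->
  0 <= t <= 1 -> K (t *: x).
Proof.
move=> hK Kx t01; have [_ _ K0] := hK.
by have := convex_body_conv K x 0 t hK Kx K0 t01; rewrite scaler0 addr0.
Qed.

Lemma closed_radial K x : closed K ->
  (forall t : R, 0 <= t < 1 -> K (t *: x)) -> K x.
Proof.
move=> cK h.
have Kt : \forall m \near \oo, K ((1 - m.+1%:R^-1 : R) *: x).
  near=> m; apply: h; rewrite subr_ge0 invf_le1 ?ltr0n// ler1n /=.
  by rewrite ltrBlDr ltrDl invr_gt0 ltr0n.
apply: (closed_cvg _ cK Kt).
rewrite -[X in _ --> X]scale1r; apply: cvgZr_tmp.
rewrite -[X in _ --> X]subr0; apply: cvgB; first exact: cvg_cst.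
exact: cvg_harmonic.
Unshelve. all: by end_near. Qed.

(** The squared distance to [p] is continuous, and only the points of [K] at
    least as close to [p] as the origin matter; they form a compact set. *)
Lemma nearest_point K p : closed K -> K 0 ->
  exists2 q, K q & forall k, K k -> dot (q - p) (q - p) <= dot (k - p) (k - p).
Proof.
move=> cK K0; pose f k := dot (k - p) (k - p).
have cf : continuous f.
  have cg : continuous (fun k : 'rV[R]_n => k - p).
    move=> k.
    exact: (@cvgB _ _ _ (nbhs k) _ id (cst p) k p (@cvg_id _ _) (cvg_cst p)).
  exact: dot_continuous.
pose A := K `&` [set k | f k <= f 0].
have cA : closed A.
  by apply: closedI => //; apply: (preimage_closed _ (@closed_le _ _)) => k _; exact: cf.
have bA : bounded_set A.
  exists (enorm p + `|p|); split; first exact: num_real.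
  move=> M /ltW hM k [_ /= kf].
  rewrite -[k](subrK p); apply: le_trans (ler_normD _ _) _; apply: le_trans hM.
  (* In the sup norm it is enough to bound each coordinate of [k - p]. *)
  rewrite lerD2r [X in X <= _]/Num.Def.normr /= mx_normrE.
  apply: bigmax_le; first exact: enorm_ge0.
  move=> [i j] _ /=; rewrite (ord1 i) -sqrtr_sqr /enorm ler_sqrt ?dot_ge0//.
  have -> : dot p p = f 0 by rewrite /f sub0r !dotE opprK.
  apply: le_trans kf; rewrite /f /dot (bigD1 j) //= expr2 lerDl.
  by apply: sumr_ge0 => l _; rewrite -expr2 sqr_ge0.
have A0 : A !=set0 by exists 0; split => //=.
have [q] := EVT_min_rV A0 (bounded_closed_compact bA cA) (continuous_subspaceT cf).
rewrite inE => -[Kq qf] qmin; exists q => // k Kk.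
have [kf|/ltW kf] := leP (f k) (f 0); last exact: le_trans kf.
by apply: qmin; rewrite inE.
Qed.

(** Otherwise moving from [q] a little towards [k] would come closer to [p]. *)
Lemma nearest_point_obtuse K p q : convex_body K -> K q ->
  (forall k, K k -> dot (q - p) (q - p) <= dot (k - p) (k - p)) ->
  forall k, K k -> 0 <= dot (q - p) (k - q).
Proof.
move=> hK Kq qmin k Kk; rewrite leNgt; apply/negP => a0.
set a := dot _ _ in a0; pose b := dot (k - q) (k - q).
have b0 : 0 <= b by exact: dot_ge0.
(* The distance is least at [- a / b], which may exceed [1]; the denominator
   [b - a] keeps [t] in [0, 1] and still decreases the distance. *)
pose t := - a / (b - a).
have ba : 0 < b - a by lra.
have t0 : 0 < t by rewrite divr_gt0// oppr_gt0.
have t1 : t <= 1 by rewrite ler_pdivrMr// mul1r; lra.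
have tE : t * (b - a) = - a by rewrite divfK// gt_eqF.
have := qmin _ (convex_body_conv K k q t hK Kk Kq _); rewrite ltW//= => /(_ t1).
have -> : t *: k + (1 - t) *: q - p = (q - p) + t *: (k - q).
  by apply/rowP => i; rewrite !mxE; ring.
move: (q - p) (k - q) @a @b a0 b0 t ba t0 t1 tE => u v a b a0 b0 t ba t0 t1 tE.
rewrite dotDl !dotDr !dotZl !dotZr (dotC v u) -/a -/b.
nra.
Qed.

(** With [q] the point of [K] nearest to [p], the functional [<p - q, _>] is at
    most its value at [q] on [K], and larger at [p] unless [p = q]. Scaled to be
    [1] at a level strictly between these two values it is in the polar. *)
Lemma bipolar K p : convex_body K -> (forall y, polar K y -> dot y p <= 1) -> K p.
Proof.
move=> hK h; have [cK _ K0] := hK.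
have [q Kq qmin] := nearest_point K p cK K0.
have obt := nearest_point_obtuse _ _ _ hK Kq qmin.
suff /eqP: q - p = 0 by rewrite subr_eq0 => /eqP <-.
apply/eqP; rewrite -dot_eq0; apply/eqP/le_anti; rewrite dot_ge0 andbT leNgt.
apply/negP => e0.
pose v := p - q.
have vE : q - p = - v by rewrite opprB.
have v0 : 0 < dot v v by move: e0; rewrite vE dotNl dotNr opprK.
have c0 : 0 <= dot v q by have := obt _ K0; rewrite vE sub0r dotNl dotNr opprK.
have vp : dot v p = dot v q + dot v v by rewrite -dotDr addrC subrK.
(* The middle level is positive even if [dot v q = 0]. *)
pose d := dot v q + dot v v / 2.
have d0 : 0 < d by rewrite /d; lra.
have : polar K (d^-1 *: v).
  move=> k Kk; rewrite dotZr mulrC ler_pdivrMr// mul1r dotC.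
  have := obt _ Kk; rewrite vE dotNl dotDr dotNr oppr_ge0 subr_le0 => vk.
  by apply: le_trans vk _; rewrite /d; lra.
move/h; rewrite dotZl mulrC ler_pdivrMr// mul1r vp /d; lra.
Qed.

End convex.

(** * Convex bodies stable under orthogonal projection onto lines *)

(** Let [x] and [v] be orthogonal with squared lengths [D] and [V]. Projecting
    [c (x + t v)] onto the line of [x + t' v] gives [c' (x + t' v)], and the
    squared length drops by [c^2 (t' - t)^2 D V / (D + t'^2 V)]. What counts is
    that this is quadratic in [t' - t]; [c <= 1] makes the bound uniform. *)
Lemma rotation_loss (R : realFieldType) (D V t t' c : R) :
  0 < D -> 0 <= V -> 0 <= t <= t' -> 0 < c <= 1 ->
  let c' := c * (D + t * t' * V) / (D + t' ^+ 2 * V) in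
  0 < c' <= 1 /\
  c ^+ 2 * (D + t ^+ 2 * V) - (t' - t) ^+ 2 * V <= c' ^+ 2 * (D + t' ^+ 2 * V).
Proof.
move=> D0 V0 /andP[t0 tt'] /andP[c0 c1] c'.
have t'0 : 0 <= t' by exact: le_trans tt'.
have ttV : t * t' * V <= t' ^+ 2 * V by rewrite ler_wpM2r// expr2 ler_wpM2r.
have ttV0 : 0 <= t * t' * V by rewrite !mulr_ge0.
rewrite /c'; set W := D + t' ^+ 2 * V.
have W0 : 0 < W by rewrite /W; lra.
have DW : D <= W by rewrite /W lerDl mulr_ge0 ?sqr_ge0.
have U0 : 0 < D + t * t' * V by rewrite ltr_wpDr.
split.
  apply/andP; split; first by rewrite divr_gt0// mulr_gt0.
  rewrite ler_pdivrMr// mul1r; apply: (@le_trans _ _ (D + t * t' * V)).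
    by rewrite ger_pMl.
  by rewrite /W lerD2l.
rewrite lerBlDl -lerBlDr.
have -> : c ^+ 2 * (D + t ^+ 2 * V) - (c * (D + t * t' * V) / W) ^+ 2 * W =
          (c ^+ 2 * (D / W)) * ((t' - t) ^+ 2 * V).
  by rewrite /W; field; rewrite gt_eqF.
apply: ler_piMl; first by rewrite mulr_ge0 ?sqr_ge0.
apply: mulr_ile1; [exact: sqr_ge0|by rewrite divr_ge0 ?ltW| |].
  by rewrite expr_le1 // ltW.
by rewrite ler_pdivrMr// mul1r.
Qed.

Section proj_stable.
Context {R : realType} {n : nat} (K : set 'rV[R]_n) (hK : convex_body K).
Context (projK : forall x (theta : 'rV[R]_n), K x -> theta != 0 ->
  K ((dot x theta / dot theta theta) *: theta)).
Implicit Types x y v z : 'rV[R]_n.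

(** Project [k] times, onto the lines of [x + e v], [x + 2 e v], and so on. The
    losses add up to [k e^2 V], with [V] the squared length of [v]; this is
    [V / m] for [k = m] and [e = 1 / m]. *)
Lemma proj_stable_rotate x v (e : R) (k : nat) :
  K x -> x != 0 -> dot x v = 0 -> 0 <= e ->
  exists c : R, [/\ 0 < c <= 1, K (c *: (x + (k%:R * e) *: v)) &
    dot x x - k%:R * e ^+ 2 * dot v v <=
    c ^+ 2 * (dot x x + (k%:R * e) ^+ 2 * dot v v)].
Proof.
move=> Kx x0 xv e0.
have D0 : 0 < dot x x by rewrite dot_gt0.
have dw s t : dot (x + s *: v) (x + t *: v) = dot x x + s * t * dot v v.
  by rewrite !dotE (dotC v x) xv; ring.
elim: k => [|k [c [c01 Kc hc]]].
  exists 1; rewrite ltr01 lexx !mul0r scale0r addr0 scale1r expr1n.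
  by split=> //; lra.
pose t := k%:R * e; pose t' := k.+1%:R * e.
have tt' : t' - t = e by rewrite /t' /t -natr1; ring.
have t01 : 0 <= t <= t' by rewrite mulr_ge0 //= -subr_ge0 tt'.
have [c'01 hc'] := rotation_loss _ _ _ _ _ _ D0 (dot_ge0 v) t01 c01.
exists (c * (dot x x + t * t' * dot v v) / (dot x x + t' ^+ 2 * dot v v)).
split=> //.
  have w0 : x + t' *: v != 0.
    by rewrite -dot_gt0 dw ltr_wpDr// mulr_ge0 ?dot_ge0// -expr2 sqr_ge0.
  by have := projK _ _ Kc w0; rewrite dotZl !dw -expr2.
apply: le_trans hc'; rewrite tt'.
by move: hc; rewrite -/t -natr1; lra.
Qed.

(** The line of [y] contains a point [x + v] with [v] orthogonal to [x], so that
    [y] is reached up to an arbitrarily small loss of length; closedness then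
    absorbs the loss. *)
Lemma proj_stable_acute x y : K x -> 0 < dot x y -> dot y y <= dot x x -> K y.
Proof.
move=> Kx xy yx; have [cK _ _] := hK.
have x0 : x != 0 by apply: contraTneq xy => ->; rewrite dot0l ltxx.
have D0 : 0 < dot x x by rewrite dot_gt0.
apply: closed_radial => // s /andP[s0 s1].
move: s0; rewrite le_eqVlt => /predU1P[<-|s0].
  by rewrite scale0r; case: hK.
pose a := dot x y / dot x x.
have a0 : 0 < a by rewrite divr_gt0.
have [v xv yE] : exists2 v, dot x v = 0 & y = a *: (x + v).
  exists (a^-1 *: y - x).
    by rewrite !dotE /a; field; rewrite !gt_eqF.
  by rewrite addrC subrK scalerA divff ?gt_eqF// scale1r.
have dwv : dot (x + v) (x + v) = dot x x + dot v v.
  by rewrite !dotE (dotC v x) xv; ring.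
have dyy : dot y y = a ^+ 2 * (dot x x + dot v v).
  by rewrite {1 2}yE dotZl dotZr dwv; ring.
have gap : 0 < dot x x - s ^+ 2 * dot y y.
  have s2 : s ^+ 2 < 1 by rewrite expr_lt1// ltW.
  have := dot_ge0 y; nra.
(* This many steps lose less than the length to spare. *)
pose m := (Num.trunc (dot v v / (dot x x - s ^+ 2 * dot y y))).+1.
have m0 : 0 < m%:R :> R by rewrite ltr0n.
have hm : dot v v / m%:R < dot x x - s ^+ 2 * dot y y.
  rewrite ltr_pdivrMr// mulrC -ltr_pdivrMr//.
  exact: truncnS_gt.
have e0 : 0 <= m%:R^-1 :> R by rewrite invr_ge0.
have [c [/andP[c0 _]]] := proj_stable_rotate x v m%:R^-1 m Kx x0 xv e0.
have me : m%:R * m%:R^-1 = 1 :> R by rewrite divff ?gt_eqF.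
have me2 : m%:R * m%:R^-1 ^+ 2 = m%:R^-1 :> R by rewrite expr2 mulrA me mul1r.
rewrite me2 me scale1r expr1n mul1r => Kc hc.
have W0 : 0 < dot x x + dot v v by rewrite ltr_wpDr ?dot_ge0.
have sac : s * a <= c.
  have : (s * a) ^+ 2 * (dot x x + dot v v) <= c ^+ 2 * (dot x x + dot v v).
    by rewrite exprMn -mulrA -dyy; rewrite mulrC in hm; lra.
  by rewrite ler_pM2r// ler_pXn2r// nnegrE ltW// mulr_gt0.
have -> : s *: y = (s * a / c) *: (c *: (x + v)).
  by rewrite scalerA divfK ?gt_eqF// yE scalerA.
apply: convex_body_shrink => //.
by rewrite ler_pdivrMr// mul1r sac divr_ge0// ltW// mulr_gt0.
Qed.

(** The bisector [x + y] makes an acute angle with both [x] and [y], so that two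
    acute rotations suffice. *)
Lemma proj_stable_non_opposite x y :
  K x -> dot y y = dot x x -> x + y != 0 -> K y.
Proof.
move=> Kx yx xy0; have z0 : 0 < dot (x + y) (x + y) by rewrite dot_gt0.
have zz : dot (x + y) (x + y) = 2 * dot x (x + y).
  by rewrite !dotE (dotC y x) yx; ring.
have xz : 0 < dot x (x + y) by lra.
have D0 : 0 < dot x x.
  by rewrite dot_gt0; apply: contraTneq xz => ->; rewrite dot0l ltxx.
have nx : 0 < enorm x by rewrite sqrtr_gt0.
have nz : 0 < enorm (x + y) by rewrite sqrtr_gt0.
pose b := enorm x / enorm (x + y).
have b0 : 0 < b by rewrite divr_gt0.
have dz : dot (b *: (x + y)) (b *: (x + y)) = dot x x.
  by rewrite dotZl dotZr -!sqr_enorm /b; field; rewrite gt_eqF.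
apply: (@proj_stable_acute (b *: (x + y))); last by rewrite dz yx.
  apply: (proj_stable_acute _ _ Kx); last by rewrite dz.
  by rewrite dotZr mulr_gt0.
rewrite dotZl mulr_gt0// (_ : dot (x + y) y = dot x (x + y))//.
by rewrite !dotE yx addrC.
Qed.

(** The point [- x] is reached through a vector orthogonal to [x]. *)
Lemma proj_stable_sphere x y : n <> 1%N -> K x -> dot y y = dot x x -> K y.
Proof.
move=> n1 Kx yx.
have [/eqP|] := eqVneq (x + y) 0; last exact: proj_stable_non_opposite.
rewrite addrC addr_eq0 => /eqP ->.
have [->|x0] := eqVneq x 0; first by rewrite oppr0; case: hK.
have [z z0 xz] := exists_orthogonal x n1 x0.
have nz : 0 < enorm z by rewrite enorm_gt0.
pose u := (enorm x / enorm z) *: z.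
have uu : dot u u = dot x x.
  by rewrite dotZl dotZr -!sqr_enorm; field; rewrite gt_eqF.
have xu : dot x u = 0 by rewrite dotZr xz mulr0.
have D0 : 0 < dot x x by rewrite dot_gt0.
have nxx : dot (- x) (- x) = dot x x by rewrite dotNl dotNr opprK.
apply: (@proj_stable_non_opposite u); rewrite ?uu//.
  apply: (@proj_stable_non_opposite x) => //.
  by rewrite -dot_gt0 dotDl !dotDr (dotC u x) xu uu; lra.
by rewrite -dot_gt0 dotDl !dotDr !dotNl !dotNr opprK (dotC u x) xu uu; lra.
Qed.

Lemma proj_stable_ball : n <> 1%N -> euclidean_ball K.
Proof.
move=> n1; have [cK _ K0] := hK.
exists (ereal_sup [set (enorm x)%:E | x in K]).
  by apply: ereal_sup_ubound; exists 0 => //; rewrite /enorm dot0l sqrtr0.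
apply/seteqP; split=> [x Kx|y /= yr]; first by apply: ereal_sup_ubound; exists x.
have [->//|y0] := eqVneq y 0.
have ny : 0 < enorm y by rewrite enorm_gt0.
(* The supremum need not be known to be attained: [s y] is strictly shorter. *)
apply: closed_radial => // s /andP[s0 s1].
have /ereal_sup_gt[_ [x Kx <-]] :
    ((enorm (s *: y))%:E < ereal_sup [set (enorm x)%:E | x in K])%E.
  by apply: lt_le_trans yr; rewrite lte_fin enormZ// gtr_pMl.
rewrite lte_fin enormZ// => syx.
have nx : 0 < enorm x by apply: le_lt_trans syx; rewrite mulr_ge0 ?enorm_ge0.
have -> : s *: y = (s * enorm y / enorm x) *: ((enorm x / enorm y) *: y).
  by rewrite scalerA; congr (_ *: _); field; rewrite !gt_eqF.
apply: convex_body_shrink => //; last first.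
  by rewrite divr_ge0 ?mulr_ge0 ?enorm_ge0//= ler_pdivrMr// mul1r ltW.
apply: (@proj_stable_sphere x) => //.
by rewrite dotZl dotZr -!sqr_enorm; field; rewrite gt_eqF.
Qed.

End proj_stable.

(** By [reciprocalP], the projection of [x] onto the line of [theta] pairs to at
    most [1] with all of the polar, so the bipolar theorem applies. *)
Lemma reciprocal_eq_polar_proj (R : realType) (n : nat) (K : set 'rV[R]_n)
    (x theta : 'rV[R]_n) :
  convex_body K -> reciprocal K = polar K -> K x -> theta != 0 ->
  K ((dot x theta / dot theta theta) *: theta).
Proof.
move=> hK KE Kx t0; have [_ _ K0] := hK.
apply: bipolar => // y; rewrite -KE => /(reciprocalP _ _ K0)/(_ _ theta Kx).
by rewrite dotZr mulrAC ler_pdivrMr ?dot_gt0// mul1r.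
Qed.

Theorem proposition2 (R : realType) (n : nat) (K T : set 'rV[R]_n)
    (hK : convex_body K) (hT : convex_body T) :
  [/\ reciprocal K `<=` polar K /\
        (n <> 1%N -> (reciprocal K = polar K <-> euclidean_ball K)),
      (T `<=` K -> reciprocal K `<=` reciprocal T),
      K `<=` reciprocal (reciprocal K) &
      reciprocal (reciprocal (reciprocal K)) = reciprocal K].
Proof.
have [_ _ K0] := hK; have [_ _ T0] := hT; split.
- split=> [|n1]; first exact: reciprocal_sub_polar.
  split=> [KE|]; last exact: ball_reciprocal.
  by apply: proj_stable_ball => // x theta Kx; exact: reciprocal_eq_polar_proj.
- exact: reciprocalS.
- exact: sub_reciprocal2.
- exact: reciprocal3.
Qed.
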